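(* (i) The point $P$ with coordinates $$X = -\frac{12(m^6-4m^2-3)}{m^2},\qquad Y = \frac{216(m^2+1)^2}{m^3}$$ is a rational point, not of finite order, on the elliptic curve over the function field $\mathbb{Q}(m)$ given by $$Y^2 = X^3 - 432(m^4-2m^2-2)(m^2+1)^2X - 1728(m^2-1)(m^2+1)^3(2m^4-4m^2-7),$$ so that infinitely many rational points on this curve can be generated using the group law. (ii) Each of these rational points yields a corresponding rational point on the curve over $\mathbb{Q}(m)$ $$V^2 = U^4 - 4(m^2+1)U^3 - 2(m^2+1)(2m^4-2m^2-3)U^2 - 4(m^2+1)^2U + (m^2+1)^2,$$ and, using the relations $t=ms$, $u=sU$, $v=s^2V$, one can find infinitely many parametric solutions of the diophantine equation $$v^2 = u^4 - \frac{4(s^2+t^2)}{s}u^3 + \frac{2(s^2+t^2)(3s^4+2s^2t^2-2t^4)}{s^4}u^2 - \frac{4(s^2+t^2)^2}{s}u + (s^2+t^2)^2.$$ (iii) One can thus obtain infinitely many parametric solutions of the problem of finding three integers $a,b,c$ such that $a+b+c$, $ab+bc+ca$ and $abc$ are all perfect squares.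
   Context: Here $m$ is an indeterminate over $\mathbb{Q}$; the two curves in (i) and (ii) are regarded as elliptic curves over $\mathbb{Q}(m)$ (the second as a quartic model), related by a birational transformation, and ''rational point'' means a point with coordinates in $\mathbb{Q}(m)$. In the last equation of (ii), $s,t,u,v$ are rational variables. Each rational solution of that equation gives a value of $u$ for which the quadratic equation $t^2x^2 - s(s^3 - 2s^2u + st^2 + su^2 - 2t^2u)x + u^2t^2(s^2+t^2)=0$ has two rational roots $x$; these together with $s^2+t^2$ are three rational numbers whose elementary symmetric functions are all squares of rational numbers, and multiplying them by a suitable perfect square gives integers. *)

(* Defs.v *)
Set Warnings "-notation-overridden,-ambiguous-paths".
From HB Require Import structures.
From mathcomp Require Import all_boot all_order all_algebra.
From mathcomp Require Import fraction polyXY.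

Set Implicit Arguments.
Unset Strict Implicit.
Unset Printing Implicit Defensive.

Import GRing.Theory.
Local Open Scope ring_scope.

Local Notation "x %:F" := (tofrac x) : ring_scope.

(** ** Affine curves y^2 = f(x) and birational maps between them *)

(* The points are taken over an extension [iota : K -> L] of the base field. *)
Definition on_curve (K L : fieldType) (iota : {rmorphism K -> L})
    (f : {poly K}) (p : L * L) : Prop :=
  p.2 ^+ 2 = (map_poly iota f).[p.1].

(* (x, y) |-> (num1 / den1, num2 / den2). *)
Record ratmap (K : fieldType) := RatMap {
  num1 : {poly {poly K}};
  den1 : {poly {poly K}};
  num2 : {poly {poly K}};
  den2 : {poly {poly K}}
}.

(* A bivariate polynomial is evaluated with its outer variable at p.1 and its
   inner variable at p.2. *)
Definition eval2 (K L : fieldType) (iota : {rmorphism K -> L})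
    (g : {poly {poly K}}) (p : L * L) : L :=
  (map_poly (map_poly iota) g).[p.1, p.2].

Definition defined_at (K L : fieldType) (iota : {rmorphism K -> L})
    (phi : ratmap K) (p : L * L) : Prop :=
  eval2 iota (den1 phi) p != 0 /\ eval2 iota (den2 phi) p != 0.

Definition rm_apply (K L : fieldType) (iota : {rmorphism K -> L})
    (phi : ratmap K) (p : L * L) : L * L :=
  (eval2 iota (num1 phi) p / eval2 iota (den1 phi) p,
   eval2 iota (num2 phi) p / eval2 iota (den2 phi) p).

(* [phi] maps y^2 = f(x) to y^2 = g(x), and [psi] inverts it wherever the
   composite makes sense, which is at all but finitely many points.  All
   extensions L of K are considered because a curve may have few points over K
   itself; the generic point of the curve, with L its function field, is
   included. *)
Definition inverse_ratmaps (K : fieldType) (f g : {poly K})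
    (phi psi : ratmap K) : Prop :=
  forall (L : fieldType) (iota : {rmorphism K -> L}),
  [/\ forall p : L * L, on_curve iota f p -> defined_at iota phi p ->
        on_curve iota g (rm_apply iota phi p),
      forall p : L * L, on_curve iota f p -> defined_at iota phi p ->
        defined_at iota psi (rm_apply iota phi p) ->
        rm_apply iota psi (rm_apply iota phi p) = p
    & exists exceptions : seq (L * L),
        forall p : L * L, on_curve iota f p -> p \notin exceptions ->
          defined_at iota phi p /\
          defined_at iota psi (rm_apply iota phi p)].

Definition birational_pair (K : fieldType) (f g : {poly K})
    (phi psi : ratmap K) : Prop :=
  inverse_ratmaps f g phi psi /\ inverse_ratmaps g f psi phi.

(** ** The chord-and-tangent law on y^2 = x^3 + a x + b, characteristic not 2 *)

Inductive ec_point (K : Type) := Infinity | Affine of K & K.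
Arguments Infinity {K}.

Definition weierstrass (K : fieldType) (a b : K) : {poly K} :=
  'X^3 + a *: 'X + b%:P.

Definition weierstrass_nonsingular (K : fieldType) (a b : K) : Prop :=
  4%:R * a ^+ 3 + 27%:R * b ^+ 2 != 0.

Definition on_ec (K : fieldType) (a b : K) (p : ec_point K) : Prop :=
  match p with
  | Infinity => True
  | Affine x y => y ^+ 2 = x ^+ 3 + a * x + b
  end.

Definition ec_opp (K : fieldType) (p : ec_point K) : ec_point K :=
  match p with
  | Infinity => Infinity
  | Affine x y => Affine x (- y)
  end.

(* The law does not involve b. *)
Definition ec_add (K : fieldType) (a : K) (p q : ec_point K) : ec_point K :=
  match p, q with
  | Infinity, _ => q
  | _, Infinity => p
  | Affine x1 y1, Affine x2 y2 =>
      if (x1 == x2) && (y1 == - y2) then Infinity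
      else
        let l := if x1 == x2 then (3%:R * x1 ^+ 2 + a) / (2%:R * y1)
                 else (y2 - y1) / (x2 - x1) in
        let x3 := l ^+ 2 - x1 - x2 in
        Affine x3 (l * (x1 - x3) - y1)
  end.

Definition ec_muln (K : fieldType) (a : K) (p : ec_point K) (n : nat) :
    ec_point K :=
  iter n (ec_add a p) Infinity.

Definition ec_mulz (K : fieldType) (a : K) (p : ec_point K) (n : int) :
    ec_point K :=
  match n with
  | Posz k => ec_muln a p k
  | Negz k => ec_opp (ec_muln a p k.+1)
  end.

(** ** The two curves over Q(m) *)

Definition Qm : fieldType := {fraction {poly rat}}.
Definition m : Qm := ('X : {poly rat})%:F.

Definition E_a : Qm :=
  - 432%:R * (m ^+ 4 - 2%:R * m ^+ 2 - 2%:R) * (m ^+ 2 + 1) ^+ 2.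

Definition E_b : Qm :=
  - 1728%:R * (m ^+ 2 - 1) * (m ^+ 2 + 1) ^+ 3
    * (2%:R * m ^+ 4 - 4%:R * m ^+ 2 - 7%:R).

Definition P : ec_point Qm :=
  Affine (- (12%:R * (m ^+ 6 - 4%:R * m ^+ 2 - 3%:R) / m ^+ 2))
         (216%:R * (m ^+ 2 + 1) ^+ 2 / m ^+ 3).

Definition quartic : {poly Qm} :=
  'X^4 - (4%:R * (m ^+ 2 + 1)) *: 'X^3
  - (2%:R * (m ^+ 2 + 1) * (2%:R * m ^+ 4 - 2%:R * m ^+ 2 - 3%:R)) *: 'X^2
  - (4%:R * (m ^+ 2 + 1) ^+ 2) *: 'X + ((m ^+ 2 + 1) ^+ 2)%:P.

(** ** The diophantine equation and the three-number problem *)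

Definition dioph_eq (F : fieldType) (s t u v : F) : Prop :=
  v ^+ 2 =
    u ^+ 4 - 4%:R * (s ^+ 2 + t ^+ 2) / s * u ^+ 3
    + 2%:R * (s ^+ 2 + t ^+ 2)
      * (3%:R * s ^+ 4 + 2%:R * s ^+ 2 * t ^+ 2 - 2%:R * t ^+ 4) / s ^+ 4
      * u ^+ 2
    - 4%:R * (s ^+ 2 + t ^+ 2) ^+ 2 / s * u + (s ^+ 2 + t ^+ 2) ^+ 2.

Definition quadratic (F : fieldType) (s t u : F) : {poly F} :=
  t ^+ 2 *: 'X^2
  - (s * (s ^+ 3 - 2%:R * s ^+ 2 * u + s * t ^+ 2 + s * u ^+ 2
          - 2%:R * t ^+ 2 * u)) *: 'X
  + (u ^+ 2 * t ^+ 2 * (s ^+ 2 + t ^+ 2))%:P.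

(* The two roots, with multiplicity. *)
Definition quadratic_roots (F : fieldType) (s t u x1 x2 : F) : Prop :=
  quadratic s t u = t ^+ 2 *: (('X - x1%:P) * ('X - x2%:P)).

Definition is_square (R : pzRingType) (x : R) : Prop := exists y : R, x = y ^+ 2.

Definition esym_squares (R : pzRingType) (a b c : R) : Prop :=
  [/\ is_square (a + b + c), is_square (a * b + b * c + c * a)
    & is_square (a * b * c)].

Definition proportional (R : pzRingType) (p q : R * R * R) : Prop :=
  exists l r : R, [/\ l != 0, r != 0,
    l * p.1.1 = r * q.1.1, l * p.1.2 = r * q.1.2 & l * p.2 = r * q.2].

(** ** Parametric solutions, in two parameters m and s *)

(* Q(m, s), built as Q(m)(s). *)
Definition Qms : fieldType := {fraction {poly Qm}}.
Definition of_Qm (x : Qm) : Qms := (x%:P)%:F.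
Definition s : Qms := ('X : {poly Qm})%:F.
Definition t : Qms := of_Qm m * s.

(* Z[m, s]: the inner variable is m, the outer one is s. *)
Definition Zms : comNzRingType := {poly {poly int}}.
Definition Zm_to_Qm (p : {poly int}) : Qm := (map_poly (intr : int -> rat) p)%:F.
Definition of_Zms (p : Zms) : Qms := (map_poly Zm_to_Qm p)%:F.
Definition value_at (p : Zms) (m0 s0 : int) : int := p.[s0%:P].[m0].

(* A parametric solution of the integer problem: a polynomial identity, hence a
   solution in integers for each choice of integer parameters. *)
Definition parametric_integer_solution (p : Zms * Zms * Zms) : Prop :=
  esym_squares p.1.1 p.1.2 p.2 /\
  forall m0 s0 : int,
    esym_squares (value_at p.1.1 m0 s0) (value_at p.1.2 m0 s0)
                 (value_at p.2 m0 s0).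

(* [p] is obtained from a value u by solving the quadratic and clearing
   denominators by a perfect square k^2. *)
Definition obtained_from (u : Qms) (p : Zms * Zms * Zms) : Prop :=
  exists x1 x2 k : Qms,
  [/\ quadratic_roots s t u x1 x2,
      esym_squares x1 x2 (s ^+ 2 + t ^+ 2),
      k != 0
    & [/\ of_Zms p.1.1 = k ^+ 2 * x1, of_Zms p.1.2 = k ^+ 2 * x2
        & of_Zms p.2 = k ^+ 2 * (s ^+ 2 + t ^+ 2)]].

(* Main.v *)
From HB Require Import structures.
Require Import Defs.
From mathcomp Require Import all_boot all_order all_algebra.
From mathcomp Require Import fraction polyXY generic_quotient.
From mathcomp Require Import ring.

Set Implicit Arguments.
Unset Strict Implicit.
Unset Printing Implicit Defensive.

Import GRing.Theory.
Local Open Scope ring_scope.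

(* Write M = m^2 + 1.  The substitution X = 36 M q - 12 M (m^2 - 1), Y = 216 M y
   turns the cubic into y^2 = M q (q^2 - (m^2 - 1) q + 1), and P into
   (1/m^2, M/m^3), which reduces to the point at infinity modulo m.  The
   reduction at m = 0 has characteristic 0, so that n P never leaves the formal
   group: by induction on n, X(nP) ~ 36 / (n^2 m^2) and Y(nP) ~ 216 / (n^3 m^3)
   at m = 0.  This gives at once that the n P are distinct and finite, and that
   they avoid the poles of the birational map, which lie over q = m^2.

   With A = U^2 - 2 M U + M the quartic is V^2 = A^2 - 4 m^4 M U^2, hence
   (A + V)(A - V) is 4 m^4 M U^2.  The function A + V is a multiple of q, namely
   A + V = 2 m^2 M q, and U = (M q + m y) / (q - m^2).

   The discriminant of the quadratic in x is s^4 V^2, and its roots are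
   s^2 (A +- V) / (2 m^2); the three symmetric functions of these roots and of
   s^2 + t^2 are the squares of s (U - M) / m, s^2 M (U - 1) / m and s^3 M U. *)

(** * The group law and values at m = 0 *)

Lemma on_ec_opp (K : fieldType) (a b : K) (p : ec_point K) :
  on_ec a b p -> on_ec a b (ec_opp p).
Proof. by case: p => //= x y; rewrite sqrrN. Qed.

(* The hypothesis on the slope l holds for the chord and for the tangent alike. *)
Lemma chord_third_point (K : fieldType) (a b l x1 y1 x2 : K) :
  y1 ^+ 2 = x1 ^+ 3 + a * x1 + b ->
  l * (2%:R * y1 + l * (x2 - x1)) = x1 ^+ 2 + x1 * x2 + x2 ^+ 2 + a ->
  let x3 := l ^+ 2 - x1 - x2 in
  (l * (x1 - x3) - y1) ^+ 2 = x3 ^+ 3 + a * x3 + b.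
Proof.
move=> e1 e2.
(* Solving the two hypotheses for [b] and [a] turns the claim into a polynomial identity in [l],
   [x1], [y1], [x2]. *)
have -> : b = y1 ^+ 2 - x1 ^+ 3 - a * x1 by rewrite e1; ring.
have -> : a = l * (2%:R * y1 + l * (x2 - x1)) - (x1 ^+ 2 + x1 * x2 + x2 ^+ 2).
  by rewrite e2; ring.
by move=> x3; rewrite /x3; ring.
Qed.

Lemma on_ec_add (K : fieldType) (a b : K) (p q : ec_point K) :
  2%:R != 0 :> K -> on_ec a b p -> on_ec a b q -> on_ec a b (ec_add a p q).
Proof.
move=> nz2; case: p => [|x1 y1] //; case: q => [|x2 y2] // e1 e2.
rewrite /ec_add; case: ifP => // xy.
case: eqVneq xy => [ex | nx] /= xy; apply: chord_third_point => //.
  (* If [y1] were 0, then [x1 = x2] would force [y2 = 0 = - y1], a case already sent to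
     [Infinity]. *)
  have ny : 2%:R * y1 != 0.
    rewrite mulf_neq0 //; apply: contraFneq xy => y10; move: e1 e2.
    rewrite /= -ex => <-; rewrite y10 expr0n /= => /eqP.
    by rewrite sqrf_eq0 => /eqP ->; rewrite oppr0.
  rewrite -ex subrr mulr0 addr0 divfK //; ring.
have nx' : x2 - x1 != 0 by rewrite subr_eq0 eq_sym.
(* Multiplied by [x2 - x1], the slope condition is the difference of the two curve equations. *)
apply: (mulIf nx'); rewrite divfK // [2%:R * y1 + _](_ : _ = y2 + y1); last by ring.
rewrite mulrAC divfK //.
transitivity (y2 ^+ 2 - y1 ^+ 2); first by ring.
by rewrite e1 e2; ring.
Qed.

Lemma on_ec_mulz (K : fieldType) (a b : K) (p : ec_point K) (n : int) :
  2%:R != 0 :> K -> on_ec a b p -> on_ec a b (ec_mulz a p n).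
Proof.
move=> nz2 onp; have onm k : on_ec a b (ec_muln a p k).
  by elim: k => //= k IHk; apply: on_ec_add.
by case: n => k; [apply: onm | apply/on_ec_opp/onm].
Qed.

Section ValueAtZero.

Variable F : fieldType.
Local Notation "x %:F" := (tofrac x).
Implicit Types (f g : {fraction {poly F}}) (c d : F).

(** The graph of the reduction map from the local ring of [F[X]] at 0 to [F]. As a relation it needs
    no chosen numerator and denominator, and a function with a pole at 0 has no value. *)
Definition has_value_at0 f c :=
  exists2 q : {poly F}, q.[0] != 0 &
    exists2 p : {poly F}, f * q%:F = p%:F & p.[0] = c * q.[0].

Lemma has_value_at0_inj f c d :
  has_value_at0 f c -> has_value_at0 f d -> c = d.
Proof.
move=> [q q0 [p fp pc]] [q' q'0 [p' fp' pd]].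
apply: (mulIf (mulf_neq0 q0 q'0)).
rewrite mulrA -pc [q.[0] * _]mulrC mulrA -pd -!hornerM.
congr (_.[0]); apply/eqP; rewrite -tofrac_eq !rmorphM /= -fp -fp'.
by apply/eqP; ring.
Qed.

Lemma has_value_at0_poly (p : {poly F}) : has_value_at0 p%:F p.[0].
Proof.
by exists 1; [rewrite hornerC oner_neq0 | exists p; rewrite ?hornerC ?rmorph1 mulr1].
Qed.

Lemma has_value_at0D f g c d : has_value_at0 f c -> has_value_at0 g d ->
  has_value_at0 (f + g) (c + d).
Proof.
move=> [q q0 [p fp pc]] [q' q'0 [p' fp' pd]]; exists (q * q').
  by rewrite hornerM mulf_neq0.
exists (p * q' + p' * q); first by rewrite rmorphD !rmorphM /= -fp -fp'; ring.
by rewrite hornerD !hornerM pc pd; ring.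
Qed.

Lemma has_value_at0M f g c d : has_value_at0 f c -> has_value_at0 g d ->
  has_value_at0 (f * g) (c * d).
Proof.
move=> [q q0 [p fp pc]] [q' q'0 [p' fp' pd]]; exists (q * q').
  by rewrite hornerM mulf_neq0.
exists (p * p'); first by rewrite !rmorphM /= -fp -fp'; ring.
by rewrite !hornerM pc pd; ring.
Qed.

Lemma has_value_at0N f c : has_value_at0 f c -> has_value_at0 (- f) (- c).
Proof.
move=> [q q0 [p fp pc]]; exists q => //.
by exists (- p); rewrite ?rmorphN /= -?fp ?hornerN ?pc; ring.
Qed.

Lemma has_value_at0B f g c d : has_value_at0 f c -> has_value_at0 g d ->
  has_value_at0 (f - g) (c - d).
Proof. by move=> fc gd; apply/has_value_at0D/has_value_at0N. Qed.

(** The zero function has value 0 and values are unique. Every nonvanishing over Q(m) that involves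
    the multiples of [P] is read off at m = 0 in this way. *)
Lemma has_value_at0_neq0 f c : c != 0 -> has_value_at0 f c -> f != 0.
Proof.
move=> c0 fc; apply: contra_neq c0 => f0; rewrite f0 in fc.
apply: (has_value_at0_inj fc).
by have := has_value_at0_poly 0; rewrite horner0 rmorph0.
Qed.

Lemma has_value_at0V f c : c != 0 ->
  has_value_at0 f c -> has_value_at0 f^-1 c^-1.
Proof.
move=> c0 fc; have f0 := has_value_at0_neq0 c0 fc.
have [q q0 [p fp pc]] := fc; exists p; first by rewrite pc mulf_neq0.
by exists q; rewrite -?fp ?pc mulrA mulVf ?mul1r.
Qed.

Lemma has_value_at0X f c k : has_value_at0 f c -> has_value_at0 (f ^+ k) (c ^+ k).
Proof.
move=> fc; elim: k => [|k IHk]; last by rewrite !exprS; apply: has_value_at0M.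
by have := has_value_at0_poly 1; rewrite hornerC rmorph1.
Qed.

Lemma has_value_at0_nat k : has_value_at0 k%:R k%:R.
Proof.
have := has_value_at0_poly k%:R.
by rewrite -polyC_natr hornerC polyC_natr rmorph_nat.
Qed.

Lemma has_value_at0_1 : has_value_at0 1 1.
Proof. exact: (has_value_at0_nat 1). Qed.

Lemma has_value_at0_X : has_value_at0 ('X%:F) 0.
Proof. by have := has_value_at0_poly 'X; rewrite hornerX. Qed.

End ValueAtZero.

Lemma eq_has_value_at0 (F : fieldType) (f g : {fraction {poly F}}) (c d : F) :
  has_value_at0 f c -> f = g -> c = d -> has_value_at0 g d.
Proof. by move=> fc <- <-. Qed.

(** Builds the value along the shape of the function, as an unevaluated expression;
    [eq_has_value_at0] then replaces it by the intended constant. *)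
Ltac value_at0 := lazymatch goal with
  | |- has_value_at0 (_ + _) _ => eapply has_value_at0D; value_at0
  | |- has_value_at0 (_ * _) _ => eapply has_value_at0M; value_at0
  | |- has_value_at0 (- _) _ => eapply has_value_at0N; value_at0
  | |- has_value_at0 (_ ^+ _) _ => eapply has_value_at0X; value_at0
  | |- has_value_at0 (_ %:R) _ => eapply has_value_at0_nat
  | |- has_value_at0 1 _ => eapply has_value_at0_1
  | |- has_value_at0 m _ => eapply has_value_at0_X
  | fc : has_value_at0 ?f _ |- has_value_at0 ?f _ => exact: fc
  end.

Lemma rat_natr_neq0 (k : nat) : (0 < k)%N -> k%:R != 0 :> rat.
Proof. by move=> k0; rewrite Num.Theory.pnatr_eq0 -lt0n. Qed.

Lemma Qm_natr_neq0 (k : nat) : (0 < k)%N -> k%:R != 0 :> Qm.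
Proof.
by move=> /rat_natr_neq0 k0; apply: has_value_at0_neq0 k0 (has_value_at0_nat _ k).
Qed.

Lemma m_neq0 : m != 0.
Proof. by rewrite /m tofrac_eq0 polyX_eq0. Qed.

Lemma m2_1_neq0 : m ^+ 2 + 1 != 0.
Proof.
apply: (@has_value_at0_neq0 _ _ (0 ^+ 2 + 1)); first by [].
value_at0.
Qed.

Lemma E_a_at0 : has_value_at0 E_a 864%:R.
Proof.
apply: eq_has_value_at0 (erefl _) _; first by rewrite /E_a; value_at0.
by apply/eqP; vm_compute.
Qed.

Lemma E_b_at0 : has_value_at0 E_b (- 12096%:R).
Proof.
apply: eq_has_value_at0 (erefl _) _; first by rewrite /E_b; value_at0.
by ring.
Qed.

(** The curve has good reduction at m = 0: since 12096 = 14 * 864, the discriminant expression takes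
    there the value 864^2 (4 * 864 + 27 * 14^2) = 864^2 * 8748. *)
Lemma E_nonsingular : weierstrass_nonsingular E_a E_b.
Proof.
have := E_a_at0; have := E_b_at0; rewrite /weierstrass_nonsingular => hb ha.
apply: (@has_value_at0_neq0 _ _ (4%:R * 864%:R ^+ 3 + 27%:R * (- 12096%:R) ^+ 2)).
  have -> : 4%:R * 864%:R ^+ 3 + 27%:R * (- 12096%:R) ^+ 2 = 864%:R ^+ 2 * 8748%:R :> rat.
    by ring.
  by apply: mulf_neq0; [apply: expf_neq0|]; apply: rat_natr_neq0.
by value_at0.
Qed.

(** * Multiples of P *)

(** The third point in the weighted coordinates x = z^2 X, y = z^3 Y; [l] is [z] times the slope in
    X and Y. With [z] equal to [m], the multiples of [P] become finite at m = 0. *)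
Definition sum_of_slope (K : fieldType) (z l x1 y1 x2 : K) : ec_point K :=
  let x3 := l ^+ 2 - x1 - x2 in
  Affine (x3 / z ^+ 2) ((l * (x1 - x3) - y1) / z ^+ 3).

Lemma ec_add_scaled (K : fieldType) (a z x1 y1 x2 y2 : K) :
  z != 0 -> x1 != x2 ->
  ec_add a (Affine (x1 / z ^+ 2) (y1 / z ^+ 3))
           (Affine (x2 / z ^+ 2) (y2 / z ^+ 3))
  = sum_of_slope z ((y2 - y1) / (x2 - x1)) x1 y1 x2.
Proof.
move=> z0 nx; have z2 : (z ^+ 2)^-1 != 0 by rewrite invr_eq0 expf_neq0.
have d0 : x2 - x1 != 0 by rewrite subr_eq0 eq_sym.
rewrite /ec_add /sum_of_slope (inj_eq (mulIf z2)) (negPf nx) /=.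
by congr Affine; field; rewrite z0 d0.
Qed.

(** The coefficient [a] has weight 4, so it enters the tangent slope as [a * z ^+ 4], which vanishes
    at m = 0 when [z] is [m]. *)
Lemma ec_double_scaled (K : fieldType) (a z x y : K) :
  z != 0 -> 2%:R != 0 :> K -> y != 0 ->
  ec_add a (Affine (x / z ^+ 2) (y / z ^+ 3)) (Affine (x / z ^+ 2) (y / z ^+ 3))
  = sum_of_slope z ((3%:R * x ^+ 2 + a * z ^+ 4) / (2%:R * y)) x y x.
Proof.
move=> z0 nz2 y0; rewrite /ec_add /sum_of_slope eqxx /=.
rewrite -subr_eq0 opprK -mulrDl -mulr2n -[y *+ 2]mulr_natl.
rewrite !mulf_eq0 (negPf nz2) (negPf y0) invr_eq0 expf_eq0 (negPf z0) /=.
by congr Affine; field; rewrite z0 y0 nz2.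
Qed.

(* The leading terms at m = 0 expected of r P; the constants 36 and 216 come from
   X ~ 36 q and Y ~ 216 y. *)
Definition has_expansion (p : ec_point Qm) (r : rat) : Prop :=
  exists2 x, has_value_at0 x (36%:R / r ^+ 2) &
  exists2 y, has_value_at0 y (216%:R / r ^+ 3) &
    p = Affine (x / m ^+ 2) (y / m ^+ 3).

Lemma sum_of_slope_expansion (l x1 y1 x2 : Qm) (r l0 x10 y10 x20 : rat) :
  has_value_at0 l l0 -> has_value_at0 x1 x10 -> has_value_at0 y1 y10 ->
  has_value_at0 x2 x20 ->
  l0 ^+ 2 - x10 - x20 = 36%:R / r ^+ 2 ->
  l0 * (x10 - 36%:R / r ^+ 2) - y10 = 216%:R / r ^+ 3 ->
  has_expansion (sum_of_slope m l x1 y1 x2) r.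
Proof.
move=> hl hx1 hy1 hx2 ex ey.
have hx3 : has_value_at0 (l ^+ 2 - x1 - x2) (36%:R / r ^+ 2).
  by apply: eq_has_value_at0 (erefl _) ex; value_at0.
exists (l ^+ 2 - x1 - x2); first exact: hx3.
exists (l * (x1 - (l ^+ 2 - x1 - x2)) - y1); last by [].
(* Once the abscissa is abstracted, [value_at0] takes its value 36 / r^2 from [hx3] instead of
   recomputing it from [l]. *)
move: (l ^+ 2 - x1 - x2) hx3 => x3 hx3.
by apply: eq_has_value_at0 (erefl _) ey; value_at0.
Qed.

Lemma P_expansion : has_expansion P 1.
Proof.
exists (- (12%:R * (m ^+ 6 - 4%:R * m ^+ 2 - 3%:R))).
  apply: eq_has_value_at0 (erefl _) _; first by value_at0.
  by field.
exists (216%:R * (m ^+ 2 + 1) ^+ 2); last by rewrite mulNr.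
apply: eq_has_value_at0 (erefl _) _; first by value_at0.
by field.
Qed.

Lemma inv_sqr_diff_neq0 (K : fieldType) (k r : K) :
  k != 0 -> r != 0 -> r - 1 != 0 -> r + 1 != 0 ->
  k / r ^+ 2 - k / 1 ^+ 2 != 0.
Proof.
move=> k0 r0 t0 s0.
rewrite expr1n divr1; have -> : k / r ^+ 2 - k = - (k * (r - 1) * (r + 1)) / r ^+ 2 by field; rewrite r0.
rewrite mulf_eq0 oppr_eq0 !mulf_eq0 invr_eq0 expf_eq0 (negPf k0).
by rewrite (negPf r0) (negPf s0) (negPf t0).
Qed.

(** At m = 0 the scaled curve degenerates to the cusp y^2 = x^3, whose points (36/r^2, 216/r^3) add
    like the parameters r; [P] has parameter 1. Excluding r = 1 and r = -1 keeps the abscissas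
    distinct at m = 0, so that the chord formula applies. *)
Lemma P_add_expansion (p : ec_point Qm) (r : rat) :
  r != 0 -> r - 1 != 0 -> r + 1 != 0 ->
  has_expansion p r -> has_expansion (ec_add E_a P p) (r + 1).
Proof.
case: P_expansion => x1 hx1 [y1 hy1 ->] r0 t0 s0 [x2 hx2 [y2 hy2 ->]].
have d0 := inv_sqr_diff_neq0 (@rat_natr_neq0 36 isT) r0 t0 s0.
have hd := has_value_at0B hx2 hx1.
have nx : x1 != x2.
  by rewrite eq_sym -subr_eq0; apply: has_value_at0_neq0 d0 hd.
rewrite (ec_add_scaled _ _ _ m_neq0 nx).
have := has_value_at0M (has_value_at0B hy2 hy1) (has_value_at0V d0 hd).
have -> : (216%:R / r ^+ 3 - 216%:R / 1 ^+ 3) * (36%:R / r ^+ 2 - 36%:R / 1 ^+ 2)^-1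
    = 6%:R * (1 + r + r ^+ 2) / (r * (r + 1)).
  by apply: (mulIf d0); rewrite (divfK d0); field; rewrite r0 s0.
move=> hl; apply: sum_of_slope_expansion hl hx1 hy1 hx2 _ _.
- by field; rewrite r0 s0.
- by field; rewrite r0 s0.
Qed.

(** The tangent at the cusp point (36, 216) has slope 3 * 36^2 / 432 = 9, and leads to (9, 27) =
    (36/2^2, 216/2^3). *)
Lemma P_double_expansion : has_expansion (ec_add E_a P P) 2%:R.
Proof.
case: P_expansion => x1 hx1 [y1 hy1 ->].
have y0 : y1 != 0 by apply: has_value_at0_neq0 hy1.
have nz2 : 2%:R != 0 :> Qm by apply: Qm_natr_neq0.
rewrite (ec_double_scaled _ _ m_neq0 nz2 y0).
have ha := E_a_at0.
have hd : has_value_at0 (2%:R * y1) 432%:R.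
  by apply: eq_has_value_at0 (erefl _) _; [value_at0 | field].
have hn : has_value_at0 (3%:R * x1 ^+ 2 + E_a * m ^+ 4) 3888%:R.
  by apply: eq_has_value_at0 (erefl _) _; [value_at0 | field].
have hl : has_value_at0 ((3%:R * x1 ^+ 2 + E_a * m ^+ 4) / (2%:R * y1)) 9%:R.
  apply: eq_has_value_at0 (has_value_at0M hn (has_value_at0V _ hd)) (erefl _) _.
    exact: rat_natr_neq0.
  by field.
by apply: (sum_of_slope_expansion hl hx1 hy1 hx1); field.
Qed.

(** The chord step excludes parameter 1, so the induction starts at 2, which the tangent
    provides. *)
Lemma muln_P_expansion (k : nat) :
  (0 < k)%N -> has_expansion (ec_muln E_a P k) k%:R.
Proof.
case: k => // k _; elim: k => [|[|k] IHk].
- by case: P_expansion => x hx [y hy e]; exists x => [|{hx}]; [exact: hx | exists y; [exact: hy | exact: e]].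
- exact: P_double_expansion.
rewrite [k.+3%:R]mulrSr; apply: P_add_expansion IHk.
- exact: rat_natr_neq0.
- by rewrite [k.+2%:R]mulrSr addrK rat_natr_neq0.
- by rewrite -mulrSr rat_natr_neq0.
Qed.

Lemma mulz_P_expansion (n : int) :
  n != 0 -> has_expansion (ec_mulz E_a P n) n%:~R.
Proof.
case: n => k k0; first by apply: muln_P_expansion; rewrite lt0n.
have [//|x hx [y hy e]] := @muln_P_expansion k.+1; rewrite /ec_mulz e.
exists x; first by rewrite NegzE mulrNz sqrrN.
exists (- y); last by rewrite mulNr.
apply: eq_has_value_at0 (has_value_at0N hy) (erefl _) _.
by rewrite NegzE mulrNz exprNn -signr_odd /= expr1 mulN1r invrN mulrN.
Qed.

Lemma mulz_P_neq_Infinity (n : int) : n != 0 -> ec_mulz E_a P n <> Infinity.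
Proof. by move=> /mulz_P_expansion [x _ [y _ ->]]. Qed.

(** The two leading coefficients determine the parameter: r is 6 times the quotient of 36/r^2 by
    216/r^3. *)
Lemma expansion_inj (p : ec_point Qm) (r s : rat) :
  r != 0 -> s != 0 -> has_expansion p r -> has_expansion p s -> r = s.
Proof.
move=> r0 s0 [x hx [y hy ->]] [x' hx' [y' hy' [ex ey]]].
have mV0 k : (m ^+ k)^-1 != 0 by rewrite invr_eq0 expf_neq0 ?m_neq0.
move/(mulIf (mV0 _)) in ex; move/(mulIf (mV0 _)) in ey.
rewrite -{}ex in hx'; rewrite -{}ey in hy'.
have := has_value_at0_inj hx hx'; have := has_value_at0_inj hy hy' => e3 e2.
have -> : r = (36%:R / r ^+ 2) / (216%:R / r ^+ 3) * 6%:R by field.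
by rewrite e2 e3; field.
Qed.

Lemma mulz_P_inj : injective (ec_mulz E_a P).
Proof.
move=> n k e.
have [n0 | n0] := eqVneq n 0; have [k0 | k0] := eqVneq k 0.
- by rewrite n0 k0.
- by case: (mulz_P_neq_Infinity k0); rewrite -e n0.
- by case: (mulz_P_neq_Infinity n0); rewrite e k0.
apply: (@intr_inj rat).
apply: expansion_inj (mulz_P_expansion n0) _; rewrite ?intr_eq0 //.
by rewrite e; apply: mulz_P_expansion.
Qed.

(** * The birational map *)

Section Formulas.

Variable R : comNzRingType.
Implicit Types c X Y U V : R.

(** These formulas live over a commutative ring so that the same expressions serve for field
    elements and, with [c%:P%:P], ['X] and ['X%:P] as arguments, for the bivariate polynomials of
    the rational maps. *)
Definition cubic_a c : R :=
  - 432%:R * (c ^+ 4 - 2%:R * c ^+ 2 - 2%:R) * (c ^+ 2 + 1) ^+ 2.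
Definition cubic_b c : R :=
  - 1728%:R * (c ^+ 2 - 1) * (c ^+ 2 + 1) ^+ 3
    * (2%:R * c ^+ 4 - 4%:R * c ^+ 2 - 7%:R).
Definition cubic_rhs c X : R := X ^+ 3 + cubic_a c * X + cubic_b c.

Definition quad c U : R := U ^+ 2 - 2%:R * (c ^+ 2 + 1) * U + (c ^+ 2 + 1).
Definition quartic_rhs c U : R :=
  quad c U ^+ 2 - 4%:R * c ^+ 4 * (c ^+ 2 + 1) * U ^+ 2.

(** With [c] for m, M = c^2 + 1 and q, y as in the opening substitution, this is 216 M (q - c^2),
    and [fwd_numU] is 216 M (M q + c y); their quotient is U. *)
Definition fwd_den c X : R :=
  6%:R * X - 72%:R * (c ^+ 2 + 1) * (2%:R * c ^+ 2 + 1).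
Definition fwd_numU c X Y : R :=
  6%:R * (c ^+ 2 + 1) * X + 72%:R * (c ^+ 2 + 1) ^+ 2 * (c ^+ 2 - 1) + c * Y.
(** V = 2 c^2 M q - A, multiplied by [18%:R * fwd_den c X ^+ 2]. *)
Definition fwd_numV c X Y : R :=
  c ^+ 2 * (X + 12%:R * (c ^+ 2 + 1) * (c ^+ 2 - 1)) * fwd_den c X ^+ 2
  - 18%:R * (fwd_numU c X Y ^+ 2
      - 2%:R * (c ^+ 2 + 1) * fwd_numU c X Y * fwd_den c X
      + (c ^+ 2 + 1) * fwd_den c X ^+ 2).

(** This solves A + V = 2 c^2 M q for X, and [bwd_numY] solves U (q - c^2) = M q + c y for Y. *)
Definition bwd_numX c U V : R :=
  18%:R * (quad c U + V) - 12%:R * c ^+ 2 * (c ^+ 2 + 1) * (c ^+ 2 - 1).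
Definition bwd_numY c U V : R :=
  108%:R * ((quad c U + V) * (U - (c ^+ 2 + 1)) - 2%:R * c ^+ 4 * (c ^+ 2 + 1) * U).

End Formulas.

Definition rmorph_formulas := (rmorph_nat, rmorph1, rmorphXn, rmorphN, rmorphD, rmorphM).

Section Birational.

Variables (K : fieldType) (c : K).
Hypotheses (natK : forall k, (0 < k)%N -> k%:R != 0 :> K)
  (c0 : c != 0) (M0 : c ^+ 2 + 1 != 0).
Implicit Types X Y U V : K.
Local Notation M := (c ^+ 2 + 1).

Definition fwdU X Y := fwd_numU c X Y / fwd_den c X.
Definition fwdV X Y := fwd_numV c X Y / (18%:R * fwd_den c X ^+ 2).
Definition bwdX U V := bwd_numX c U V / c ^+ 2.
Definition bwdY U V := bwd_numY c U V / c ^+ 3.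

Lemma fwdVE X Y : fwd_den c X != 0 ->
  fwdV X Y = c ^+ 2 * (X + 12%:R * M * (c ^+ 2 - 1)) / 18%:R - quad c (fwdU X Y).
Proof.
move=> d0; rewrite /fwdV /fwdU /fwd_numV /quad.
move: (fwd_den c X) (fwd_numU c X Y) d0 => d u d0.
by field; rewrite d0 natK.
Qed.

Lemma fwd_defect X Y : fwd_den c X != 0 ->
  fwdV X Y ^+ 2 - quartic_rhs c (fwdU X Y)
  = - (c ^+ 4 / (54%:R * fwd_den c X)) * (Y ^+ 2 - cubic_rhs c X).
Proof.
move=> d0; rewrite fwdVE // /quartic_rhs.
set S := _ / 18%:R; set U := fwdU X Y; rewrite /quad.
(* With V = S - A the terms A^2 cancel; what is left is quadratic in U, so [fwd_den c X ^+ 2] clears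
   its denominators. *)
transitivity (U ^+ 2 * (4%:R * c ^+ 4 * M - 2%:R * S) + 4%:R * S * M * U
  + S ^+ 2 - 2%:R * S * M); first by ring.
apply: (mulIf (expf_neq0 2 d0)).
rewrite /U /S /fwdU /fwd_numU /cubic_rhs /cubic_a /cubic_b; move: d0; rewrite /fwd_den => d0.
by field; rewrite d0 !natK.
Qed.

Lemma fwd_on_curve X Y : fwd_den c X != 0 -> Y ^+ 2 = cubic_rhs c X ->
  fwdV X Y ^+ 2 = quartic_rhs c (fwdU X Y).
Proof.
move=> d0 e; apply/eqP; rewrite -subr_eq0 fwd_defect // e subrr mulr0 //.
Qed.

(** The two defects are proportional with the factor inverse to that of [fwd_defect]; as this factor
    is now a multiple of [fwd_den], the argument also covers its zeros. *)
Lemma bwd_on_curve U V : V ^+ 2 = quartic_rhs c U ->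
  bwdY U V ^+ 2 = cubic_rhs c (bwdX U V).
Proof.
move=> e; apply/eqP; rewrite -subr_eq0.
have -> : bwdY U V ^+ 2 - cubic_rhs c (bwdX U V)
  = - (54%:R * fwd_den c (bwdX U V) / c ^+ 4) * (V ^+ 2 - quartic_rhs c U).
  rewrite /bwdY /bwdX /bwd_numX /bwd_numY /cubic_rhs /cubic_a /cubic_b /fwd_den.
  rewrite /quartic_rhs /quad.
  by field; rewrite c0.
by rewrite e subrr mulr0.
Qed.

Lemma fwdK X Y : fwd_den c X != 0 ->
  bwdX (fwdU X Y) (fwdV X Y) = X /\ bwdY (fwdU X Y) (fwdV X Y) = Y.
Proof.
move=> d0; rewrite fwdVE // /bwdX /bwdY /bwd_numX /bwd_numY [quad _ _ + _]addrC subrK.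
split; first by field; rewrite c0 !natK.
rewrite /fwdU /fwd_numU; move: d0; rewrite /fwd_den => d0.
by field; rewrite c0 d0 !natK.
Qed.

Lemma bwdK U V : fwd_den c (bwdX U V) != 0 ->
  fwdU (bwdX U V) (bwdY U V) = U /\ fwdV (bwdX U V) (bwdY U V) = V.
Proof.
move=> d0.
have eU : fwdU (bwdX U V) (bwdY U V) = U.
  apply: (mulIf d0); rewrite divfK // /fwd_numU /fwd_den /bwdX /bwdY /bwd_numX /bwd_numY.
  by rewrite /quad; field; rewrite c0.
split=> //; rewrite fwdVE // eU /bwdX /bwd_numX.
by field; rewrite c0 natK.
Qed.

(** At q = c^2 the cubic y^2 = M q (q^2 - (c^2 - 1) q + 1) gives y^2 = M^2 c^2, hence two points. *)
Lemma fwd_den_eq0 X Y : Y ^+ 2 = cubic_rhs c X -> fwd_den c X = 0 ->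
  (X, Y) \in [:: (12%:R * M * (2%:R * c ^+ 2 + 1), 216%:R * M ^+ 2 * c);
                 (12%:R * M * (2%:R * c ^+ 2 + 1), - (216%:R * M ^+ 2 * c))].
Proof.
move=> e d0; have eX : X = 12%:R * M * (2%:R * c ^+ 2 + 1).
  have n6 : 6%:R != 0 :> K by rewrite natK.
  by apply: (mulfI n6); apply/eqP; rewrite -subr_eq0 -d0 /fwd_den; apply/eqP; ring.
rewrite !inE -!pair_eqE /= -eX !eqxx /= -eqf_sqr e eX.
by rewrite /cubic_rhs /cubic_a /cubic_b; apply/eqP; ring.
Qed.

Lemma fwd_den_bwd_eq0 U V : V ^+ 2 = quartic_rhs c U -> fwd_den c (bwdX U V) = 0 ->
  (U, V) \in [:: ((1 - c ^+ 4) / 2%:R,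
                  2%:R * c ^+ 4 * M - quad c ((1 - c ^+ 4) / 2%:R))].
Proof.
move=> e d0; have n2 : 2%:R != 0 :> K by rewrite natK.
have eV : V = 2%:R * c ^+ 4 * M - quad c U.
  apply/eqP; rewrite -subr_eq0.
  have <- : fwd_den c (bwdX U V) * c ^+ 2 / 108%:R = V - (2%:R * c ^+ 4 * M - quad c U).
    by rewrite /fwd_den /bwdX /bwd_numX; field; rewrite c0 !natK.
  by rewrite d0 !mul0r.
have n4M : 4%:R * c ^+ 4 * M * (2%:R * M) != 0 by rewrite !mulf_neq0 ?expf_neq0 ?natK.
have eU : U = (1 - c ^+ 4) / 2%:R.
  apply/eqP; rewrite -subr_eq0 -(mulrI_eq0 _ (mulfI n4M)).
  (* For V = 2 c^4 M - A the terms in A^2 and U^2 cancel, and the quartic equation becomes linear in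
     U: a single point lies over q = c^2. *)
  have <- : V ^+ 2 - quartic_rhs c U = 4%:R * c ^+ 4 * M * (2%:R * M) * (U - (1 - c ^+ 4) / 2%:R).
    by rewrite eV /quartic_rhs /quad; field; rewrite natK.
  by rewrite e subrr.
by rewrite /= inE -pair_eqE /= -eU -eV !eqxx.
Qed.

End Birational.

(** * Evaluation of bivariate polynomials *)

Section Eval2.

Variables (K L : fieldType) (iota : {rmorphism K -> L}) (p : L * L).
Implicit Types (c : K) (g h : {poly {poly K}}).

Lemma eval2_X : eval2 iota 'X p = p.1.
Proof. by rewrite /eval2 map_polyX hornerX hornerC. Qed.

Lemma eval2_Y : eval2 iota 'X%:P p = p.2.
Proof. by rewrite /eval2 map_polyC hornerC /= map_polyX hornerX. Qed.

Lemma eval2_C c : eval2 iota c%:P%:P p = iota c.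
Proof. by rewrite /eval2 map_polyC hornerC /= map_polyC hornerC. Qed.

Lemma eval2_nat k : eval2 iota k%:R p = k%:R.
Proof. by rewrite -polyC_natr -polyC_natr eval2_C rmorph_nat. Qed.

Lemma eval2_1 : eval2 iota 1 p = 1.
Proof. exact: (eval2_nat 1). Qed.

Lemma eval2D g h : eval2 iota (g + h) p = eval2 iota g p + eval2 iota h p.
Proof. by rewrite /eval2 rmorphD !hornerD. Qed.

Lemma eval2N g : eval2 iota (- g) p = - eval2 iota g p.
Proof. by rewrite /eval2 rmorphN !hornerN. Qed.

Lemma eval2M g h : eval2 iota (g * h) p = eval2 iota g p * eval2 iota h p.
Proof. by rewrite /eval2 rmorphM !hornerM. Qed.

Lemma eval2Xn g k : eval2 iota (g ^+ k) p = eval2 iota g p ^+ k.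
Proof. by elim: k => [|k IHk]; rewrite ?eval2_1 // !exprS eval2M IHk. Qed.

Definition eval2E := (eval2_nat, eval2_1, eval2Xn, eval2N, eval2D, eval2M).

Variable c : K.

Lemma eval2_fwd_den : eval2 iota (fwd_den c%:P%:P 'X) p = fwd_den (iota c) p.1.
Proof. by rewrite /fwd_den !eval2E eval2_C eval2_X. Qed.

Lemma eval2_fwd_numU :
  eval2 iota (fwd_numU c%:P%:P 'X 'X%:P) p = fwd_numU (iota c) p.1 p.2.
Proof. by rewrite /fwd_numU !eval2E eval2_C eval2_X eval2_Y. Qed.

Lemma eval2_fwd_numV :
  eval2 iota (fwd_numV c%:P%:P 'X 'X%:P) p = fwd_numV (iota c) p.1 p.2.
Proof.
by rewrite /fwd_numV !(eval2_fwd_den, eval2_fwd_numU, eval2E) eval2_C eval2_X.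
Qed.

Lemma eval2_fwd_denV :
  eval2 iota (18%:R * fwd_den c%:P%:P 'X ^+ 2) p = 18%:R * fwd_den (iota c) p.1 ^+ 2.
Proof. by rewrite !(eval2_fwd_den, eval2E). Qed.

Lemma eval2_bwd_numX :
  eval2 iota (bwd_numX c%:P%:P 'X 'X%:P) p = bwd_numX (iota c) p.1 p.2.
Proof. by rewrite /bwd_numX /quad !eval2E eval2_C eval2_X eval2_Y. Qed.

Lemma eval2_bwd_numY :
  eval2 iota (bwd_numY c%:P%:P 'X 'X%:P) p = bwd_numY (iota c) p.1 p.2.
Proof. by rewrite /bwd_numY /quad !eval2E eval2_C eval2_X eval2_Y. Qed.

Lemma eval2_constX k : eval2 iota (c%:P%:P ^+ k) p = iota c ^+ k.
Proof. by rewrite eval2Xn eval2_C. Qed.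

End Eval2.

(** * The two rational maps over extensions of Q(m) *)

Definition phi : ratmap Qm := RatMap
  (fwd_numU m%:P%:P 'X 'X%:P) (fwd_den m%:P%:P 'X)
  (fwd_numV m%:P%:P 'X 'X%:P) (18%:R * fwd_den m%:P%:P 'X ^+ 2).

Definition psi : ratmap Qm := RatMap
  (bwd_numX m%:P%:P 'X 'X%:P) (m%:P%:P ^+ 2)
  (bwd_numY m%:P%:P 'X 'X%:P) (m%:P%:P ^+ 3).

Section OverExtension.

Variables (L : fieldType) (iota : {rmorphism Qm -> L}).
Local Notation c := (iota m).
Implicit Type p : L * L.

Lemma natL k : (0 < k)%N -> k%:R != 0 :> L.
Proof. by move=> k0; rewrite -(rmorph_nat iota) fmorph_eq0 Qm_natr_neq0. Qed.

Lemma iota_m_neq0 : c != 0.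
Proof. by rewrite fmorph_eq0 m_neq0. Qed.

Lemma iota_m2_1_neq0 : c ^+ 2 + 1 != 0.
Proof. by rewrite -rmorphXn -(rmorph1 iota) -rmorphD fmorph_eq0 m2_1_neq0. Qed.

Lemma on_curve_weierstrass p :
  on_curve iota (weierstrass E_a E_b) p <-> p.2 ^+ 2 = cubic_rhs c p.1.
Proof.
have -> : cubic_rhs c p.1 = p.1 ^+ 3 + iota E_a * p.1 + iota E_b.
  by rewrite /cubic_rhs /cubic_a /cubic_b /E_a /E_b !rmorph_formulas.
rewrite /on_curve /weierstrass !rmorphD /= map_polyXn linearZ /= map_polyX map_polyC.
by rewrite !hornerE.
Qed.

Lemma horner_map_quartic u : (map_poly iota quartic).[u] = quartic_rhs c u.
Proof.
rewrite /quartic !rmorphD !rmorphN /= !linearZ /= !map_polyXn map_polyX map_polyC.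
rewrite !hornerE /= !rmorph_formulas /quartic_rhs /quad.
by ring.
Qed.

Lemma on_curve_quartic p :
  on_curve iota quartic p <-> p.2 ^+ 2 = quartic_rhs c p.1.
Proof. by rewrite -horner_map_quartic. Qed.

Lemma rm_apply_phi p : rm_apply iota phi p = (fwdU c p.1 p.2, fwdV c p.1 p.2).
Proof.
by rewrite /rm_apply eval2_fwd_numU eval2_fwd_den eval2_fwd_numV eval2_fwd_denV.
Qed.

Lemma rm_apply_psi p : rm_apply iota psi p = (bwdX c p.1 p.2, bwdY c p.1 p.2).
Proof. by rewrite /rm_apply eval2_bwd_numX eval2_bwd_numY !eval2_constX. Qed.

Lemma defined_at_phi p : defined_at iota phi p <-> fwd_den c p.1 != 0.
Proof.
rewrite /defined_at eval2_fwd_denV eval2_fwd_den; split=> [[] //|d0]; split=> //.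
by apply: mulf_neq0; [apply: natL | apply: expf_neq0].
Qed.

Lemma defined_at_psi p : defined_at iota psi p.
Proof.
rewrite /defined_at !eval2_constX.
by split; apply/expf_neq0/iota_m_neq0.
Qed.

End OverExtension.

Lemma birational_phi_psi : birational_pair (weierstrass E_a E_b) quartic phi psi.
Proof.
split=> L iota; have nat0 := natL iota; have c0 := iota_m_neq0 iota.
- split.
  + move=> p /on_curve_weierstrass e /defined_at_phi d0; apply/on_curve_quartic.
    by rewrite rm_apply_phi; apply: fwd_on_curve.
  + move=> [x y] _ /defined_at_phi d0 _; rewrite rm_apply_psi rm_apply_phi /=.
    by have [-> ->] := fwdK nat0 c0 y d0.
  (* The exceptional list is supplied by unification with [fwd_den_eq0]; it depends only on the
     image of [m]. *)
  + eexists => -[x y] /on_curve_weierstrass e exc; split; last exact: defined_at_psi.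
    by apply/defined_at_phi; apply: contraNneq exc; apply: fwd_den_eq0.
- split.
  + move=> p /on_curve_quartic e _; apply/on_curve_weierstrass.
    by rewrite rm_apply_psi; apply: bwd_on_curve.
  + move=> [u v] _ _ /defined_at_phi; rewrite rm_apply_psi /= => d0.
    by rewrite rm_apply_phi /=; have [-> ->] := bwdK nat0 c0 d0.
  + eexists => -[u v] /on_curve_quartic e exc; split; first exact: defined_at_psi.
    apply/defined_at_phi; rewrite rm_apply_psi; apply: contraNneq exc.
    by apply: fwd_den_bwd_eq0 => //; apply: iota_m2_1_neq0.
Qed.

(** * Clearing denominators *)

Section NumDen.
Local Open Scope quotient_scope.

Lemma fraction_num_den (R : idomainType) (x : {fraction R}) :
  exists n d : R, d != 0 /\ x * tofrac d = tofrac n.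
Proof.
elim/quotW: x => r; exists (\n_r), (\d_r); split; first exact: denom_ratioP.
change (FracField.mul (\pi r) (FracField.tofrac \d_r) = FracField.tofrac \n_r).
rewrite !piE /FracField.mulf; apply/eqmodP => /=.
rewrite FracField.equivfE !numden_Ratio ?(oner_eq0, mulf_neq0, denom_ratioP) //.
by rewrite !mulr1 mulrC.
Qed.

End NumDen.

Lemma map_intr_poly_inj : injective (map_poly (intr : int -> rat)).
Proof. by apply: map_inj_poly => //; apply: intr_inj. Qed.

HB.instance Definition _ :=
  GRing.RMorphism.copy Zm_to_Qm (@tofrac {poly rat} \o map_poly (intr : int -> rat)).

Lemma Zm_to_QmM : {morph Zm_to_Qm : p q / p * q}.
Proof. exact: rmorphM. Qed.

Lemma Zm_to_Qm_inj : injective Zm_to_Qm.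
Proof.
move=> p q /eqP; rewrite /Zm_to_Qm tofrac_eq => /eqP; exact: map_intr_poly_inj.
Qed.

Lemma Zm_to_QmX : Zm_to_Qm 'X = m.
Proof. by rewrite /Zm_to_Qm map_polyX. Qed.

(** Write x = p/q over Q, with p = p'/a and q = q'/b for integral p' and q'; then x = (b p') / (a
    q'). *)
Lemma clear_denominator (x : Qm) :
  exists n d : {poly int}, d != 0 /\ Zm_to_Qm d * x = Zm_to_Qm n.
Proof.
have [p [q [q0 xq]]] := fraction_num_den x.
have [p' [a a0 ep]] := rat_poly_scale p; have [q' [b b0 eq]] := rat_poly_scale q.
have intC (c : int) : Zm_to_Qm c%:P = tofrac (c%:~R)%:P.
  by rewrite /Zm_to_Qm map_polyC.
have aE : (a%:~R : rat) != 0 by rewrite intr_eq0.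
have bE : (b%:~R : rat) != 0 by rewrite intr_eq0.
have ep' : Zm_to_Qm p' = tofrac (a%:~R)%:P * tofrac p.
  by rewrite ep -rmorphM /= mul_polyC scalerA mulfV // scale1r.
have eq' : Zm_to_Qm q' = tofrac (b%:~R)%:P * tofrac q.
  by rewrite eq -rmorphM /= mul_polyC scalerA mulfV // scale1r.
exists (b%:P * p'), (a%:P * q'); split.
  rewrite mulf_neq0 ?polyC_eq0 //; apply: contra_neq q0 => q'0.
  by rewrite eq q'0 map_poly0 scaler0.
by rewrite !rmorphM /= !intC ep' eq' -xq; ring.
Qed.

Lemma ex_common_denominator (x y : Qm) :
  exists n k d : {poly int},
    [/\ d != 0, Zm_to_Qm d * x = Zm_to_Qm n & Zm_to_Qm d * y = Zm_to_Qm k].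
Proof.
have [n [d [d0 e]]] := clear_denominator x.
have [n' [d' [d'0 e']]] := clear_denominator y.
exists (n * d'), (d * n'), (d * d'); split; first exact: mulf_neq0.
- by rewrite !Zm_to_QmM -e; ring.
- by rewrite !Zm_to_QmM -e'; ring.
Qed.

(** Boolean conditions let [sigW] turn existence into data, so that the integer triple becomes a
    function of the point. *)
Lemma common_denominator (x y : Qm) :
  {nkd : {poly int} * {poly int} * {poly int}
   | [&& nkd.2 != 0, Zm_to_Qm nkd.2 * x == Zm_to_Qm nkd.1.1
      & Zm_to_Qm nkd.2 * y == Zm_to_Qm nkd.1.2]}.
Proof.
apply: sigW; have [n [k [d [d0 /eqP e /eqP e']]]] := ex_common_denominator x y.
exists (n, k, d); apply/and3P; split; [exact: d0 | exact: e | exact: e'].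
Qed.

(** * The three numbers *)

Section Triple.

Variable R : comNzRingType.
Implicit Types c s n k d : R.

Definition hquad c n d : R :=
  n ^+ 2 - 2%:R * (c ^+ 2 + 1) * d * n + (c ^+ 2 + 1) * d ^+ 2.

(** At U = n/d and V = k/d, these are the two roots and s^2 + t^2, with t = c s, multiplied by (2 c
    d)^2; [hquad c n d] is d^2 A. *)
Definition triple c s n k d : R * R * R :=
  (2%:R * (hquad c n d + d * k) * s ^+ 2, 2%:R * (hquad c n d - d * k) * s ^+ 2,
   4%:R * c ^+ 2 * d ^+ 2 * (c ^+ 2 + 1) * s ^+ 2).

(** The hypothesis is the quartic equation times d^4. The square roots are s (U - M)/c, s^2 M (U -
    1)/c and s^3 M U times the first, second and third power of 2 c d, so no division remains. *)
Lemma esym_squares_triple c s n k d :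
  (d * k) ^+ 2 = hquad c n d ^+ 2 - 4%:R * c ^+ 4 * (c ^+ 2 + 1) * d ^+ 2 * n ^+ 2 ->
  let abc := triple c s n k d in esym_squares abc.1.1 abc.1.2 abc.2.
Proof.
move=> e /=; split.
- by exists (2%:R * s * (n - (c ^+ 2 + 1) * d)); rewrite /hquad; ring.
- exists (4%:R * s ^+ 2 * c * d * (c ^+ 2 + 1) * (n - d)).
  transitivity (4%:R * s ^+ 4 * (hquad c n d ^+ 2 - (d * k) ^+ 2)
    + 16%:R * c ^+ 2 * d ^+ 2 * (c ^+ 2 + 1) * s ^+ 4 * hquad c n d); first by ring.
  by rewrite e /hquad; ring.
- exists (8%:R * s ^+ 3 * c ^+ 3 * d ^+ 2 * (c ^+ 2 + 1) * n).
  transitivity (16%:R * c ^+ 2 * d ^+ 2 * (c ^+ 2 + 1) * s ^+ 6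
    * (hquad c n d ^+ 2 - (d * k) ^+ 2)); first by ring.
  by rewrite e; ring.
Qed.

End Triple.

Lemma esym_squares_rmorph (R S : comNzRingType) (f : {rmorphism R -> S}) (a b c : R) :
  esym_squares a b c -> esym_squares (f a) (f b) (f c).
Proof.
move=> [[x ex] [y ey] [z ez]]; split.
- by exists (f x); rewrite -rmorphXn -ex !rmorphD.
- by exists (f y); rewrite -rmorphXn -ey !(rmorphD, rmorphM).
- by exists (f z); rewrite -rmorphXn -ez !rmorphM.
Qed.

Section Diophantine.

Variables (F : fieldType) (c s : F).
Hypotheses (nz2 : 2%:R != 0 :> F) (c0 : c != 0) (M0 : c ^+ 2 + 1 != 0) (s0 : s != 0).
Implicit Types U V : F.

Definition quadratic_root U V := s ^+ 2 * (quad c U + V) / (2%:R * c ^+ 2).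

Lemma dioph_eq_of_quartic U V : V ^+ 2 = quartic_rhs c U ->
  dioph_eq s (c * s) (s * U) (s ^+ 2 * V).
Proof.
by move=> e; rewrite /dioph_eq exprMn e /quartic_rhs /quad; field; rewrite s0.
Qed.

Let nz4 : 4%:R != 0 :> F.
Proof. by rewrite (natrM _ 2 2) mulf_neq0. Qed.

Lemma quadratic_rootsP U V : V ^+ 2 = quartic_rhs c U ->
  quadratic_roots s (c * s) (s * U) (quadratic_root U V) (quadratic_root U (- V)).
Proof.
move=> e; rewrite /quadratic_roots /quadratic.
set x1 := quadratic_root _ _; set x2 := quadratic_root _ _.
rewrite [X in _ - X *: _](_ : _ = (c * s) ^+ 2 * (x1 + x2)); last first.
  by rewrite /x1 /x2 /quadratic_root /quad; field; rewrite c0 nz2.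
rewrite [X in _ + X%:P](_ : _ = (c * s) ^+ 2 * (x1 * x2)); last first.
  (* The product of the roots involves V only through A^2 - V^2 = 4 c^4 M U^2. *)
  transitivity (s ^+ 6 / (4%:R * c ^+ 2) * (quad c U ^+ 2 - V ^+ 2)).
    by rewrite e /quartic_rhs; field; rewrite c0 nz4.
  by rewrite /x1 /x2 /quadratic_root; field; rewrite c0 nz2 ?nz4.
by rewrite -!mul_polyC !(polyCM, polyCD); ring.
Qed.

Lemma esym_squares_quadratic_root U V : V ^+ 2 = quartic_rhs c U ->
  esym_squares (quadratic_root U V) (quadratic_root U (- V)) (s ^+ 2 + (c * s) ^+ 2).
Proof.
move=> e.
have prod : quadratic_root U V * quadratic_root U (- V)
    = s ^+ 4 * (c ^+ 2 + 1) * U ^+ 2.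
  transitivity (s ^+ 4 / (2%:R * c ^+ 2) ^+ 2 * (quad c U ^+ 2 - V ^+ 2)).
    by rewrite /quadratic_root; field; rewrite c0 nz2.
  by rewrite e /quartic_rhs; field; rewrite c0 nz2.
have sum : quadratic_root U V + quadratic_root U (- V) = s ^+ 2 * quad c U / c ^+ 2.
  by rewrite /quadratic_root; field; rewrite c0 nz2.
split.
(* Since M + c^2 M = M^2, one has A + c^2 M = (U - M)^2. *)
- exists (s * (U - (c ^+ 2 + 1)) / c); rewrite sum /quad.
  by field; rewrite c0.
(* Here the identity is c^2 U^2 + A = M (U - 1)^2. *)
- exists (s ^+ 2 * (c ^+ 2 + 1) * (U - 1) / c).
  set x1 := quadratic_root U V in sum prod *; set x2 := quadratic_root _ _ in sum prod *.
  transitivity (x1 * x2 + (s ^+ 2 + (c * s) ^+ 2) * (x1 + x2)); first by ring.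
  by rewrite prod sum /quad; field; rewrite c0.
- by exists (s ^+ 3 * (c ^+ 2 + 1) * U); rewrite prod; ring.
Qed.

Lemma triple_quadratic_root U V d n k : d != 0 -> d * U = n -> d * V = k ->
  let l := 2%:R * c * d in
  triple c s n k d = (l ^+ 2 * quadratic_root U V, l ^+ 2 * quadratic_root U (- V),
                      l ^+ 2 * (s ^+ 2 + (c * s) ^+ 2)).
Proof.
move=> d0 <- <- l; rewrite /triple /l /quadratic_root /hquad /quad.
congr (_, _, _); last by ring.
  by field; rewrite c0 nz2.
by field; rewrite c0 nz2.
Qed.

(** The difference of the roots gives V and their sum gives A. Then 4 c^4 M U^2 = A^2 - V^2 gives
    U^2, and 2 M U = U^2 + M - A gives U itself without a sign ambiguity. *)
Lemma quadratic_root_inj U V U' V' :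
  V ^+ 2 = quartic_rhs c U -> V' ^+ 2 = quartic_rhs c U' ->
  quadratic_root U V = quadratic_root U' V' ->
  quadratic_root U (- V) = quadratic_root U' (- V') -> U = U' /\ V = V'.
Proof.
move=> e e' e1 e2.
have eV : V = V'.
  have dE W W' : W' = c ^+ 2 / s ^+ 2 * (quadratic_root W W' - quadratic_root W (- W')).
    by rewrite /quadratic_root; field; rewrite s0 c0 nz2.
  by rewrite (dE U V) (dE U' V') e1 e2.
have eq : quad c U = quad c U'.
  have qE W W' : quad c W
      = c ^+ 2 / s ^+ 2 * (quadratic_root W W' + quadratic_root W (- W')).
    by rewrite /quadratic_root; field; rewrite s0 c0 nz2.
  by rewrite (qE U V) (qE U' V') e1 e2.
split=> //.
have nz : 4%:R * c ^+ 4 * (c ^+ 2 + 1) != 0.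
  by rewrite !mulf_neq0 ?expf_neq0.
have eU2 : U ^+ 2 = U' ^+ 2.
  have uE W W' : W' ^+ 2 = quartic_rhs c W ->
      4%:R * c ^+ 4 * (c ^+ 2 + 1) * W ^+ 2 = quad c W ^+ 2 - W' ^+ 2.
    by move=> ->; rewrite /quartic_rhs; ring.
  by apply: (mulfI nz); rewrite (uE _ _ e) (uE _ _ e') eV eq.
apply: (mulfI (mulf_neq0 nz2 M0)).
have mE W : 2%:R * (c ^+ 2 + 1) * W = W ^+ 2 + (c ^+ 2 + 1) - quad c W.
  by rewrite /quad; ring.
by rewrite (mE U) (mE U') eU2 eq.
Qed.

End Diophantine.

(** * The multiples of [P] and their images on the quartic *)

Lemma E_a_eq : E_a = cubic_a m. Proof. by []. Qed.
Lemma E_b_eq : E_b = cubic_b m. Proof. by []. Qed.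

Lemma cubic_rhs_P (K : fieldType) (c : K) : c != 0 ->
  (216%:R * (c ^+ 2 + 1) ^+ 2 / c ^+ 3) ^+ 2
  = cubic_rhs c (- (12%:R * (c ^+ 6 - 4%:R * c ^+ 2 - 3%:R) / c ^+ 2)).
Proof. by move=> c0; rewrite /cubic_rhs /cubic_a /cubic_b; field; rewrite c0. Qed.

Lemma P_on_ec : on_ec E_a E_b P.
Proof. exact: cubic_rhs_P m_neq0. Qed.

Lemma fwd_den_scaled (K : fieldType) (c x : K) : c != 0 ->
  c ^+ 2 * fwd_den c (x / c ^+ 2)
  = 6%:R * x - 72%:R * c ^+ 2 * (c ^+ 2 + 1) * (2%:R * c ^+ 2 + 1).
Proof. by move=> c0; rewrite /fwd_den; field; rewrite c0. Qed.

(** After multiplication by m^2 the denominator takes the nonzero value 6 * 36 / r^2 at m = 0. *)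
Lemma fwd_den_neq0 (x : Qm) (r : rat) : r != 0 ->
  has_value_at0 x (36%:R / r ^+ 2) -> fwd_den m (x / m ^+ 2) != 0.
Proof.
move=> r0 hx.
have h : has_value_at0
    (6%:R * x - 72%:R * m ^+ 2 * (m ^+ 2 + 1) * (2%:R * m ^+ 2 + 1)) (216%:R / r ^+ 2).
  by apply: eq_has_value_at0 (erefl _) _; [value_at0 | field].
have h0 : 216%:R / r ^+ 2 != 0.
  by apply: mulf_neq0; [apply: rat_natr_neq0 | rewrite invr_eq0 expf_neq0].
have := has_value_at0_neq0 h0 h; apply: contra_neq => d0.
by rewrite -(fwd_den_scaled x m_neq0) d0 mulr0.
Qed.

Lemma mulz_P_affine (n : int) : n != 0 -> exists X Y : Qm,
  [/\ ec_mulz E_a P n = Affine X Y, fwd_den m X != 0 & Y ^+ 2 = cubic_rhs m X].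
Proof.
move=> n0; have [x hx [y hy e]] := mulz_P_expansion n0.
exists (x / m ^+ 2), (y / m ^+ 3); split; first exact: e.
  by apply: fwd_den_neq0 hx; rewrite intr_eq0.
have := on_ec_mulz n (@Qm_natr_neq0 2 isT) P_on_ec.
by rewrite e /on_ec E_a_eq E_b_eq.
Qed.

(** The default (0, 0) is reached only at n = 0, where the multiple is [Infinity]. *)
Definition image_point (n : int) : Qm * Qm :=
  if ec_mulz E_a P n is Affine X Y then (fwdU m X Y, fwdV m X Y) else (0, 0).

Lemma image_point_on_quartic (n : int) : n != 0 ->
  (image_point n).2 ^+ 2 = quartic_rhs m (image_point n).1.
Proof.
move=> n0; have [X [Y [e d0 eY]]] := mulz_P_affine n0.
rewrite /image_point e; apply: (fwd_on_curve Qm_natr_neq0 d0 eY).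
Qed.

Lemma image_point_inj (n k : int) : n != 0 -> k != 0 ->
  image_point n = image_point k -> n = k.
Proof.
move=> n0 k0.
have [X [Y [e d0 _]]] := mulz_P_affine n0; have [X' [Y' [e' d'0 _]]] := mulz_P_affine k0.
rewrite /image_point e e' => -[eU eV]; apply: mulz_P_inj; rewrite e e'.
have [eX eY] := fwdK Qm_natr_neq0 m_neq0 Y d0.
have [eX' eY'] := fwdK Qm_natr_neq0 m_neq0 Y' d'0.
by congr Affine; [rewrite -[LHS]eX -[RHS]eX' | rewrite -[LHS]eY -[RHS]eY']; rewrite eU eV.
Qed.

Lemma image_point_phi (n : int) (X Y : Qm) : ec_mulz E_a P n = Affine X Y ->
  image_point n = rm_apply (idfun : {rmorphism Qm -> Qm}) phi (X, Y).
Proof. by move=> e; rewrite /image_point e rm_apply_phi. Qed.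

Lemma quarticE (U : Qm) : quartic.[U] = quartic_rhs m U.
Proof.
have <- := horner_map_quartic (idfun : {rmorphism Qm -> Qm}) U.
by rewrite map_poly_id.
Qed.

(** * Embeddings of Q(m) and Z[m, s] into Q(m, s) *)

HB.instance Definition _ :=
  GRing.RMorphism.copy of_Qm (@tofrac {poly Qm} \o (polyC : Qm -> {poly Qm})).
HB.instance Definition _ :=
  GRing.RMorphism.copy of_Zms (@tofrac {poly Qm} \o map_poly Zm_to_Qm).

Lemma of_QmM : {morph of_Qm : x y / x * y}. Proof. exact: rmorphM. Qed.
Lemma of_QmD : {morph of_Qm : x y / x + y}. Proof. exact: rmorphD. Qed.
Lemma of_QmN : {morph of_Qm : x / - x}. Proof. exact: rmorphN. Qed.
Lemma of_QmX k : {morph of_Qm : x / x ^+ k}. Proof. exact: rmorphXn. Qed.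
Lemma of_Qm_nat k : of_Qm k%:R = k%:R. Proof. exact: rmorph_nat. Qed.
Lemma of_Qm1 : of_Qm 1 = 1. Proof. exact: rmorph1. Qed.
Lemma of_Qm_inj : injective of_Qm. Proof. exact: fmorph_inj. Qed.

Definition of_QmE := (of_Qm_nat, of_Qm1, of_QmX, of_QmN, of_QmM, of_QmD).

Lemma of_Qm_quartic (U V : Qm) : V ^+ 2 = quartic_rhs m U ->
  of_Qm V ^+ 2 = quartic_rhs (of_Qm m) (of_Qm U).
Proof. by rewrite -of_QmX => ->; rewrite /quartic_rhs /quad !of_QmE. Qed.

Lemma of_Qm_neq0 (x : Qm) : x != 0 -> of_Qm x != 0.
Proof. by rewrite fmorph_eq0. Qed.

Lemma of_ZmsM : {morph of_Zms : x y / x * y}. Proof. exact: rmorphM. Qed.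
Lemma of_ZmsD : {morph of_Zms : x y / x + y}. Proof. exact: rmorphD. Qed.
Lemma of_ZmsN : {morph of_Zms : x / - x}. Proof. exact: rmorphN. Qed.
Lemma of_ZmsX k : {morph of_Zms : x / x ^+ k}. Proof. exact: rmorphXn. Qed.
Lemma of_Zms_nat k : of_Zms k%:R = k%:R. Proof. exact: rmorph_nat. Qed.
Lemma of_Zms1 : of_Zms 1 = 1. Proof. exact: rmorph1. Qed.

Lemma of_Zms_s : of_Zms 'X = s.
Proof. by rewrite /of_Zms map_polyX. Qed.

Lemma of_ZmsC (p : {poly int}) : of_Zms p%:P = of_Qm (Zm_to_Qm p).
Proof. by rewrite /of_Zms map_polyC. Qed.

Lemma of_Zms_neq0 (p : Zms) : p != 0 -> of_Zms p != 0.
Proof.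
apply: contra_neq => /eqP; rewrite /of_Zms tofrac_eq0 => /eqP p0.
by apply: (map_inj_poly Zm_to_Qm_inj (rmorph0 _)); rewrite p0 map_poly0.
Qed.

Definition of_ZmsE := (of_Zms_nat, of_Zms1, of_ZmsX, of_ZmsN, of_ZmsM, of_ZmsD).

Lemma of_Zms_triple (c s n k d : Zms) :
  (of_Zms (triple c s n k d).1.1, of_Zms (triple c s n k d).1.2,
   of_Zms (triple c s n k d).2)
  = triple (of_Zms c) (of_Zms s) (of_Zms n) (of_Zms k) (of_Zms d).
Proof. by rewrite /triple /hquad /= !of_ZmsE. Qed.

(** In [Zms] the parameter m is ['X%:P] and s is ['X]. *)
Definition abc_of (U V : Qm) : Zms * Zms * Zms :=
  let nkd := sval (common_denominator U V) in
  triple 'X%:P 'X nkd.1.1%:P nkd.1.2%:P nkd.2%:P.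

Lemma s_neq0 : s != 0.
Proof. by rewrite /s tofrac_eq0 polyX_eq0. Qed.

Lemma Qms_2_neq0 : 2%:R != 0 :> Qms.
Proof. by rewrite -of_Qm_nat of_Qm_neq0 // Qm_natr_neq0. Qed.

Lemma of_Qm_m2_1_neq0 : of_Qm m ^+ 2 + 1 != 0.
Proof. by rewrite -of_QmX -of_Qm1 -of_QmD of_Qm_neq0 // m2_1_neq0. Qed.

Local Notation rootx := (quadratic_root (of_Qm m) s).

Lemma abc_of_spec (U V : Qm) : exists2 l : Qms, l != 0 &
  [/\ of_Zms (abc_of U V).1.1 = l ^+ 2 * rootx (of_Qm U) (of_Qm V),
      of_Zms (abc_of U V).1.2 = l ^+ 2 * rootx (of_Qm U) (- of_Qm V)
    & of_Zms (abc_of U V).2 = l ^+ 2 * (s ^+ 2 + t ^+ 2)].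
Proof.
rewrite /abc_of; have := svalP (common_denominator U V).
case: (sval _) => -[n k] d; rewrite [_.2]/= [_.1.1]/= [_.1.2]/=.
move=> /and3P[d0 /eqP en /eqP ek].
have D0 : of_Qm (Zm_to_Qm d) != 0.
  apply: of_Qm_neq0; apply: contra_neq d0 => d0; apply: Zm_to_Qm_inj.
  by rewrite d0 rmorph0.
(* The multiplier 2 c d of [triple_quadratic_root], at c = m. *)
exists (2%:R * of_Qm m * of_Qm (Zm_to_Qm d)).
  exact: mulf_neq0 (mulf_neq0 Qms_2_neq0 (of_Qm_neq0 m_neq0)) D0.
have := of_Zms_triple 'X%:P 'X n%:P k%:P d%:P.
rewrite !of_ZmsC of_Zms_s Zm_to_QmX.
have eU := etrans (esym (of_QmM _ _)) (congr1 of_Qm en).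
have eV := etrans (esym (of_QmM _ _)) (congr1 of_Qm ek).
rewrite (triple_quadratic_root s Qms_2_neq0 (of_Qm_neq0 m_neq0) D0 eU eV).
by move=> [-> -> ->].
Qed.

Lemma abc_of_esym_squares (U V : Qm) : V ^+ 2 = quartic_rhs m U ->
  parametric_integer_solution (abc_of U V).
Proof.
move=> e; have h : esym_squares (abc_of U V).1.1 (abc_of U V).1.2 (abc_of U V).2.
  rewrite /abc_of; have := svalP (common_denominator U V).
  case: (sval _) => -[n k] d; rewrite [_.2]/= [_.1.1]/= [_.1.2]/=.
  move=> /and3P[_ /eqP en /eqP ek]; apply: esym_squares_triple.
  (* The identity in Z[m] follows from the quartic equation in Q(m) by injectivity; it is then
     carried to Z[m, s] by constants. *)
  have : (d * k) ^+ 2 = hquad 'X n d ^+ 2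
      - 4%:R * 'X ^+ 4 * ('X ^+ 2 + 1) * d ^+ 2 * n ^+ 2.
    apply: Zm_to_Qm_inj; rewrite /hquad !rmorph_formulas /= Zm_to_QmX -en -ek.
    move: (Zm_to_Qm d) => D.
    transitivity (D ^+ 4 * V ^+ 2); first by ring.
    by rewrite e /quartic_rhs /quad; ring.
  move/(congr1 (polyC : {poly int} -> Zms)); rewrite /hquad.
  by rewrite !rmorph_formulas.
split=> // m0 s0.
(* Substituting integers for s and m is a ring morphism, so it preserves the three squares. *)
exact: (esym_squares_rmorph (horner_eval m0 \o horner_eval s0%:P) h).
Qed.

Lemma abc_of_obtained (U V : Qm) : V ^+ 2 = quartic_rhs m U ->
  obtained_from (s * of_Qm U) (abc_of U V).
Proof.
move=> /of_Qm_quartic e; have [l l0 eqs] := abc_of_spec U V.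
exists (rootx (of_Qm U) (of_Qm V)), (rootx (of_Qm U) (- of_Qm V)), l.
have c0 := of_Qm_neq0 m_neq0.
split; [exact: quadratic_rootsP Qms_2_neq0 c0 _ _ e
  | exact: esym_squares_quadratic_root Qms_2_neq0 c0 _ _ e | exact: l0 | exact: eqs].
Qed.

(** Both triples have s^2 + t^2 as third entry up to their multipliers, so proportionality matches
    the total multipliers; the ordered roots then agree and determine the point. *)
Lemma abc_of_proportional (U V U' V' : Qm) :
  V ^+ 2 = quartic_rhs m U -> V' ^+ 2 = quartic_rhs m U' ->
  proportional (abc_of U V) (abc_of U' V') -> U = U' /\ V = V'.
Proof.
move=> e e' [l [r [l0 r0 ea eb ec]]].
have [j j0 [ja jb jc]] := abc_of_spec U V.
have [k k0 [ka kb kc]] := abc_of_spec U' V'.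
have c0 := of_Qm_neq0 m_neq0.
have w0 : s ^+ 2 + t ^+ 2 != 0.
  have -> : s ^+ 2 + t ^+ 2 = s ^+ 2 * (of_Qm m ^+ 2 + 1) by rewrite /t; ring.
  exact: mulf_neq0 (expf_neq0 2 s_neq0) of_Qm_m2_1_neq0.
have lj : of_Zms l * j ^+ 2 = of_Zms r * k ^+ 2.
  by apply: (mulIf w0); rewrite -[LHS]mulrA -[RHS]mulrA -jc -kc -!of_ZmsM ec.
have lj0 := mulf_neq0 (of_Zms_neq0 l0) (expf_neq0 2 j0).
have cancel (x x' : Qms) (a a' : Zms) : of_Zms a = j ^+ 2 * x ->
    of_Zms a' = k ^+ 2 * x' -> l * a = r * a' -> x = x'.
  move=> ax ax' aa'; apply: (mulfI lj0).
  by rewrite [RHS](congr1 ( *%R^~ _) lj) -[LHS]mulrA -[RHS]mulrA -ax -ax' -!of_ZmsM aa'.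
have [eU eV] := quadratic_root_inj Qms_2_neq0 c0 of_Qm_m2_1_neq0 s_neq0
  (of_Qm_quartic e) (of_Qm_quartic e') (cancel _ _ _ _ ja ka ea) (cancel _ _ _ _ jb kb eb).
by split; apply: of_Qm_inj; [exact: eU | exact: eV].
Qed.

Theorem mainTheorem5 :
  (* (i) *)
  [/\ weierstrass_nonsingular E_a E_b,
      on_ec E_a E_b P,
      forall n : nat, (0 < n)%N -> ec_muln E_a P n <> Infinity,
      forall n : int, on_ec E_a E_b (ec_mulz E_a P n)
    & injective (ec_mulz E_a P)]
  /\
  exists (phi psi : ratmap Qm) (U V : int -> Qm),
  (* (ii) *)
  [/\ birational_pair (weierstrass E_a E_b) quartic phi psi,
      forall n : int, n != 0 -> exists X Y : Qm,
        [/\ ec_mulz E_a P n = Affine X Y,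
            defined_at (idfun : {rmorphism Qm -> Qm}) phi (X, Y),
            (U n, V n) = rm_apply (idfun : {rmorphism Qm -> Qm}) phi (X, Y)
          & V n ^+ 2 = quartic.[U n]],
      forall n : int, n != 0 ->
        dioph_eq s t (s * of_Qm (U n)) (s ^+ 2 * of_Qm (V n))
    & forall n k : int, n != 0 -> k != 0 ->
        (s * of_Qm (U n), s ^+ 2 * of_Qm (V n))
          = (s * of_Qm (U k), s ^+ 2 * of_Qm (V k)) -> n = k]
  /\
  (* (iii) *)
  exists abc : int -> Zms * Zms * Zms,
    (forall n : int, n != 0 ->
       obtained_from (s * of_Qm (U n)) (abc n) /\
       parametric_integer_solution (abc n)) /\
    (forall n k : int, n != 0 -> k != 0 ->
       proportional (abc n) (abc k) -> n = k).
Proof.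
split.
  split; [exact: E_nonsingular | exact: P_on_ec | | | exact: mulz_P_inj].
  - by move=> n n0; apply: (@mulz_P_neq_Infinity n); rewrite -lt0n in n0 *.
  - by move=> n; apply: on_ec_mulz P_on_ec; apply: Qm_natr_neq0.
(* At n = 0 these witnesses take the default value (0, 0), which the condition [n != 0] of the
   clauses excludes. *)
exists phi, psi, (fun n => (image_point n).1), (fun n => (image_point n).2).
have on_quartic n : n != 0 -> (image_point n).2 ^+ 2 = quartic_rhs m (image_point n).1.
  exact: image_point_on_quartic.
split; first split.
- exact: birational_phi_psi.
- move=> n n0; have [X [Y [e d0 _]]] := mulz_P_affine n0; exists X, Y; split.
  + exact: e.
  + exact/(defined_at_phi (idfun : {rmorphism Qm -> Qm}) (X, Y)).
  + by rewrite -(image_point_phi e) -surjective_pairing.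
  + by rewrite quarticE on_quartic.
- move=> n n0; apply: dioph_eq_of_quartic s_neq0 _ _ _.
  exact: of_Qm_quartic (on_quartic n n0).
- move=> n k n0 k0 e; apply: image_point_inj n0 k0 _.
  have eU : s * of_Qm (image_point n).1 = s * of_Qm (image_point k).1 := congr1 fst e.
  have eV : s ^+ 2 * of_Qm (image_point n).2 = s ^+ 2 * of_Qm (image_point k).2 :=
    congr1 snd e.
  rewrite [LHS]surjective_pairing [RHS]surjective_pairing.
  rewrite (of_Qm_inj (mulfI s_neq0 eU)).
  by rewrite (of_Qm_inj (mulfI (expf_neq0 2 s_neq0) eV)).
exists (fun n => abc_of (image_point n).1 (image_point n).2); split.
- move=> n n0; split; first exact: abc_of_obtained (on_quartic n n0).
  exact: abc_of_esym_squares (on_quartic n n0).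
- move=> n k n0 k0 prop.
  have [eU eV] := abc_of_proportional (on_quartic n n0) (on_quartic k k0) prop.
  apply: image_point_inj n0 k0 _.
  by rewrite [LHS]surjective_pairing [RHS]surjective_pairing eU eV.
Qed.
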